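(* Let $\mathcal{X}\subset\mathbb{R}^d$ be an infinite compact set, let $m\ge2$, let $\psi_1,\dots,\psi_K:\mathcal{X}\to\mathbb{R}$ be Lipschitz with Lipschitz constants at most $1$, and let $\hat Q_1,\dots,\hat Q_m$ be empirical distributions of finite training sequences in $\mathcal{X}$. Let $0<\Delta<\eta_0<\eta_{\max}$, let $\eta\in[\Delta,\eta_0]$, and for $\epsilon>0$ with $\eta+\epsilon\le\eta_0$ let $\mathcal{S}_N=\{z_1,\dots,z_N\}\subset\mathcal{X}$ (with $N=N(\epsilon)$) be a finite $\epsilon$-net of $\mathcal{X}$, i.e. $\min_{j\in[N]}\|z_j-x\|\le\epsilon$ for every $x\in\mathcal{X}$. Let $$\gamma=\inf_\phi\ \sup_{P_i\in\mathcal{P}_i^\eta,\ i\in[m]}P_E(\phi;P_1,\dots,P_m)$$ be the optimal value of the minmax Bayes problem, and let $$\gamma_{N,\epsilon}=\inf_{\phi_N}\ \sup_{P_{i,N}\in\mathcal{P}_{i,N}^{\eta+\epsilon},\ i\in[m]}\ 1-\frac1m\sum_{i=1}^m\sum_{j=1}^N\phi_{i,N}(z_j)\,p_{i,N}(z_j)$$ be the optimal value of its finite-dimensional approximation. Then, as $\epsilon\to0$ (equivalently $N\to\infty$), $\gamma_{N,\epsilon}$ converges to $\gamma$, with $$|\gamma_{N,\epsilon}-\gamma|\le L_0\,\epsilon,$$ where $L_0<\infty$ is the Lipschitz constant on $[\Delta,\eta_0]$ of the function $g$ that maps a radius $r$ to the optimal value $g(r)=\inf_\phi\sup_{P_i\in\mathcal{P}_i^{r},\,i\in[m]}P_E(\phi;P_1,\dots,P_m)$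 of the minmax problem with radius $r$.
   Context: $[n]=\{1,\dots,n\}$. $\mathcal{P}$ is the set of all Borel probability measures on $\mathcal{X}$. For each $i\in[m]$, $\hat Q_i=\frac1{n_i}\sum_{j=1}^{n_i}\delta(\hat x_{i,j})$ is the empirical distribution of training points $\hat x_{i,1},\dots,\hat x_{i,n_i}\in\mathcal{X}$, and $E_P[\psi]$ is the expectation of $\psi(X)$ under $X\sim P$. For a radius $r>0$, $\mathcal{P}_i^{r}=\{P\in\mathcal{P}:|E_P[\psi_k]-E_{\hat Q_i}[\psi_k]|\le r,\ k\in[K]\}$, and $\mathcal{P}_{i,N}^{r}$ is the set of those $P\in\mathcal{P}_i^{r}$ that are supported on $\mathcal{S}_N$ (with probability mass function $p_{i,N}$ on $\mathcal{S}_N$). $\eta_{\max}>0$ is the maximum (supremal) radius $r$ for which $\mathcal{P}_1^{r},\dots,\mathcal{P}_m^{r}$ do not overlap (are pairwise disjoint). A decision rule on $\mathcal{X}$ is a measurable $\phi=(\phi_1,\dots,\phi_m):\mathcal{X}\to\Delta_m$, where $\Delta_m=\{v\in[0,1]^m:\sum_iv_i=1\}$; a decision rule on $\mathcal{S}_N$ is a function $\phi_N=(\phi_{1,N},\dots,\phi_{m,N}):\mathcal{S}_N\to\Delta_m$. The Bayes error probability (equal priors) is $P_E(\phi;P_1,\dots,P_m)=1-\frac1m\sum_{i=1}^m\int_{\mathcal{X}}\phi_i\,dP_i$. $\|\cdot\|$ is the norm on $\mathbb{R}^d$, which is also the one used for the Lipschitz constants of the $\psi_k$. *)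

(* Defs.v *)
From HB Require Import structures.
From mathcomp Require Import all_boot all_order all_algebra.
From mathcomp Require Import all_classical all_reals all_analysis.

Set Implicit Arguments.
Unset Strict Implicit.
Unset Printing Implicit Defensive.

Import Order.TTheory GRing.Theory Num.Theory.
Import numFieldNormedType.Exports.

Local Open Scope classical_set_scope.
Local Open Scope ring_scope.

(* R^d with its Borel sigma-algebra. The topology of 'rV[R]_d is the product
   topology, i.e. the topology of every norm on R^d. *)
Notation borelRd R d := (g_sigma_algebraType (@open 'rV[R]_d)).

(* The norm is not fixed: every norm on R^d is allowed, and the same one is
   used for the Lipschitz constants and for the nets. *)
Record is_norm (R : realType) (d : nat) (nrm : 'rV[R]_d -> R) : Prop := IsNorm {
  norm_triangle : forall x y, nrm (x + y) <= nrm x + nrm y;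
  norm_scale : forall (a : R) x, nrm (a *: x) = `|a| * nrm x;
  norm_eq0 : forall x, nrm x = 0 -> x = 0 }.

Definition lipschitz_wrt (R : realType) (d : nat) (nrm : 'rV[R]_d -> R) (L : R)
    (X : set 'rV[R]_d) (f : 'rV[R]_d -> R) : Prop :=
  forall x y, X x -> X y -> `|f x - f y| <= L * nrm (x - y).

(* The points z_0, ..., z_(N-1) are pairwise distinct, so that N is the
   cardinality of the net and sums over the index run once over each point. *)
Definition eps_net (R : realType) (d : nat) (nrm : 'rV[R]_d -> R)
    (X : set 'rV[R]_d) (eps : R) (N : nat) (z : 'I_N -> 'rV[R]_d) : Prop :=
  [/\ injective z, forall j, X (z j)
    & forall x, X x -> exists j, nrm (z j - x) <= eps].

(* Borel probability measures on X, as Borel probability measures on R^d giving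
   mass 1 to X (used for X compact, hence Borel); correspondingly, functions on
   X are functions on R^d of which only the values on X matter, and they are
   integrated over X. *)
Definition prob_on (R : realType) (d : nat) (X : set 'rV[R]_d) :
    set (probability (borelRd R d) R) :=
  [set P | P X = 1%E].

Definition empirical (R : realType) (d : nat) (xs : seq 'rV[R]_d) :
    {measure set (borelRd R d) -> \bar R} :=
  mscale ((size xs)%:R^-1)%:nng
    (msum (fun j => dirac (nth 0 xs j : borelRd R d)) (size xs)).

Definition expect (R : realType) (d : nat) (X : set 'rV[R]_d)
    (P : {measure set (borelRd R d) -> \bar R}) (f : 'rV[R]_d -> R) : R :=
  \int[P]_(x in (X : set (borelRd R d))) f x.

Definition ambiguity (R : realType) (d K : nat) (X : set 'rV[R]_d)
    (psi : 'I_K -> 'rV[R]_d -> R) (xs : seq 'rV[R]_d) (r : R) :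
    set (probability (borelRd R d) R) :=
  [set P | prob_on X P /\
    forall k, `|expect X P (psi k) - expect X (empirical xs) (psi k)| <= r].

Definition ambiguity_net (R : realType) (d K : nat) (X : set 'rV[R]_d)
    (psi : 'I_K -> 'rV[R]_d -> R) (xs : seq 'rV[R]_d)
    (N : nat) (z : 'I_N -> 'rV[R]_d) (r : R) :
    set (probability (borelRd R d) R) :=
  [set P | ambiguity X psi xs r P /\ P (range z) = 1%E].

Definition pmf (R : realType) (d : nat) (P : probability (borelRd R d) R)
    (x : 'rV[R]_d) : R :=
  fine (P [set x]).

(* An extended real, so that no convention on suprema of unbounded or empty
   sets of reals is involved. *)
Definition eta_max (R : realType) (d K m : nat) (X : set 'rV[R]_d)
    (psi : 'I_K -> 'rV[R]_d -> R) (xhat : 'I_m -> seq 'rV[R]_d) : \bar R :=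
  ereal_sup [set r%:E | r in [set r : R |
    0 < r /\ trivIset setT (fun i => ambiguity X psi (xhat i) r)]].

Definition simplex (R : realType) (m : nat) : set (m.-tuple R) :=
  [set v | (forall i, 0 <= tnth v i <= 1) /\ \sum_(i < m) tnth v i = 1].

Definition decision_rule (R : realType) (d m : nat) (X : set 'rV[R]_d) :
    set ('rV[R]_d -> m.-tuple R) :=
  [set phi | measurable_fun (X : set (borelRd R d)) (phi : borelRd R d -> m.-tuple R)
    /\ forall x, X x -> simplex (phi x)].

Definition decision_rule_net (R : realType) (d m : nat)
    (N : nat) (z : 'I_N -> 'rV[R]_d) : set ('rV[R]_d -> m.-tuple R) :=
  [set phi | forall j, simplex (phi (z j))].

Definition bayes_error (R : realType) (d m : nat) (X : set 'rV[R]_d)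
    (phi : 'rV[R]_d -> m.-tuple R)
    (P : 'I_m -> probability (borelRd R d) R) : R :=
  1 - m%:R^-1 * \sum_(i < m) expect X (P i) (fun x => tnth (phi x) i).

Definition bayes_error_net (R : realType) (d m : nat)
    (N : nat) (z : 'I_N -> 'rV[R]_d) (phi : 'rV[R]_d -> m.-tuple R)
    (P : 'I_m -> probability (borelRd R d) R) : R :=
  1 - m%:R^-1 *
    \sum_(i < m) \sum_(j < N) tnth (phi (z j)) i * pmf (P i) (z j).

Definition minmax_value (R : realType) (d K m : nat) (X : set 'rV[R]_d)
    (psi : 'I_K -> 'rV[R]_d -> R) (xhat : 'I_m -> seq 'rV[R]_d) (r : R) : R :=
  inf [set sup [set bayes_error X phi P | P in
                [set P | forall i, ambiguity X psi (xhat i) r (P i)]]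
      | phi in @decision_rule R d m X].

Definition minmax_value_net (R : realType) (d K m : nat) (X : set 'rV[R]_d)
    (psi : 'I_K -> 'rV[R]_d -> R) (xhat : 'I_m -> seq 'rV[R]_d)
    (N : nat) (z : 'I_N -> 'rV[R]_d) (r : R) : R :=
  inf [set sup [set bayes_error_net z phi P | P in
                [set P | forall i, ambiguity_net X psi (xhat i) z r (P i)]]
      | phi in @decision_rule_net R d m N z].

(* The best Lipschitz constant of g on A; +oo when g is not Lipschitz on A. *)
Definition lipschitz_constant (R : realType) (A : set R) (g : R -> R) : \bar R :=
  ereal_inf [set k%:E | k in
    [set k : R | 0 <= k /\ k.-lipschitz_A (g : R^o -> R^o)]].

(* Main.v *)
(* A rule on [X] restricts to a rule on the net, and the measures on the net form
   a subset of the ambiguity set of radius [eta + eps], so that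
   [gamma_net <= g (eta + eps)]. Conversely, moving every point of [X] to a net
   point at distance at most [eps] changes the moments of the 1-Lipschitz
   [psi k] by at most [eps], so it maps the ambiguity set of radius [eta] into
   the one of radius [eta + eps] on the net, and composing rules on the net with
   this projection gives [g eta <= gamma_net].
   Finally, for [r <= s], mixing a measure in the ambiguity set of radius [s]
   with a fraction [(s - r) / s] of the empirical measure puts it into the one
   of radius [r] and changes the error by at most [(s - r) / s]; hence [g],
   which is nondecreasing, is Lipschitz on [[Delta, eta0]] with constant
   [1 / Delta]. *)
Require Import Defs.
From HB Require Import structures.
From mathcomp Require Import all_boot all_order all_algebra.
From mathcomp Require Import all_classical all_reals all_analysis.
From mathcomp Require Import measurable_realfun ring lra.

Set Implicit Arguments.
Unset Strict Implicit.
Unset Printing Implicit Defensive.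

Import Order.TTheory GRing.Theory Num.Theory.
Import numFieldNormedType.Exports.

Local Open Scope classical_set_scope.
Local Open Scope ring_scope.

(** * Comparison of inf-sup values *)

(** Each rule [a2] of the right-hand game is answered by some [a1], and each adversary [b1] against
    [a1] is simulated by some [b2]. The bounds in [[0, 1]] and nonemptiness keep every [sup] and
    [inf] away from default values; the last hypothesis carries the points of [A2] and [B1] over to
    [A1] and [B2]. *)
Lemma inf_sup_le (R : realType) (T1 U1 T2 U2 : Type) (A1 : set T1) (B1 : set U1)
    (F1 : T1 -> U1 -> R) (A2 : set T2) (B2 : set U2) (F2 : T2 -> U2 -> R)
    (c : R) :
  A2 !=set0 -> B1 !=set0 ->
  (forall a b, A1 a -> B1 b -> 0 <= F1 a b <= 1) ->
  (forall a b, A2 a -> B2 b -> 0 <= F2 a b <= 1) ->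
  (forall a2, A2 a2 -> exists2 a1, A1 a1 &
    forall b1, B1 b1 -> exists2 b2, B2 b2 & F1 a1 b1 <= F2 a2 b2 + c) ->
  inf [set sup [set F1 a b | b in B1] | a in A1] <=
  inf [set sup [set F2 a b | b in B2] | a in A2] + c.
Proof.
move=> [a0 A2a0] [b0 B1b0] F1_01 F2_01 dom; rewrite -lerBlDr.
apply: lb_le_inf; first by exists (sup [set F2 a0 b | b in B2]), a0.
move=> _ [a2 A2a2 <-]; rewrite lerBlDr; have [a1 A1a1 le12] := dom _ A2a2.
have lb_inf : has_lbound [set sup [set F1 a b | b in B1] | a in A1].
  exists 0 => _ [a A1a <-]; have /andP[Fa_ge0 _] := F1_01 _ _ A1a B1b0.
  apply: (le_trans Fa_ge0); apply: ub_le_sup; last by exists b0.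
  by exists 1 => _ [b B1b <-]; have /andP[] := F1_01 _ _ A1a B1b.
apply: (@le_trans _ _ (sup [set F1 a1 b | b in B1])).
  by apply: ge_inf => //; exists a1.
apply: ge_sup; first by exists (F1 a1 b0), b0.
move=> _ [b1 B1b1 <-]; have [b2 B2b2 /le_trans->//] := le12 _ B1b1.
rewrite lerD2r; apply: ub_le_sup; last by exists b2.
by exists 1 => _ [b B2b <-]; have /andP[] := F2_01 _ _ A2a2 B2b.
Qed.

(** * Step functions, mixtures and integrals against probabilities *)

Lemma measurable_fun_finite_partition dd (T : measurableType dd) dd'
    (U : measurableType dd') (N : nat) (B : 'I_N -> set T) (f : T -> U)
    (F : 'I_N -> U) :
  (forall j, measurable (B j)) -> (forall j x, B j x -> f x = F j) ->
  measurable_fun (\bigcup_j B j) f.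
Proof.
move=> mB fF _ Y mY.
rewrite [X in measurable X](_ : _ = \bigcup_(j in [set j | Y (F j)]) B j).
  exact: fin_bigcup_measurable.
apply/seteqP; split=> x.
  by move=> [[j _ Bjx]] /=; rewrite (fF j)// => YF; exists j.
by move=> [j /= YF Bjx]; split; [exists j|rewrite /= (fF j)].
Qed.

Section probability_tools.
Context dd (T : measurableType dd) (R : realType).

(** Gives a measure of total mass 1 the type [probability]: [mnormalize] divides by the mass, here
    1, so its Dirac fallback never enters. *)
Lemma probability_of_measure (mu : {measure set T -> \bar R}) :
  mu setT = 1%E ->
  exists P : probability T R, (P : set T -> \bar R) = (mu : set T -> \bar R).
Proof.
move=> mu1; exists (mnormalize mu (@dirac _ _ point R)).
by apply/funext => A; rewrite /= /mnormalize mu1 onee_eq0/= invr1 mule1.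
Qed.

Lemma probability_mixture (P Q : probability T R) (t : R) : 0 <= t <= 1 ->
  exists S : probability T R,
    (forall A, S A = (1 - t)%:E * P A + t%:E * Q A)%E /\
    forall (D : set T) (f : T -> R), measurable D -> measurable_fun D f ->
      [bounded f x | x in D] ->
      \int[S]_(x in D) f x =
      (1 - t) * \int[P]_(x in D) f x + t * \int[Q]_(x in D) f x.
Proof.
move=> /andP[t0 t1]; have t1' : 0 <= 1 - t by rewrite subr_ge0.
pose mu : {measure set T -> \bar R} :=
  measure_add (mscale (NngNum t1') P) (mscale (NngNum t0) Q).
have muE A : (mu A = (1 - t)%:E * P A + t%:E * Q A)%E.
  exact: measure_addE.
have [|S SE] := @probability_of_measure mu.
  by apply: etrans (muE _) _; rewrite !probability_setT !mule1 -EFinD subrK.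
exists S; split => [A|D f mD mf bf]; first by rewrite SE; exact: muE.
have fint (nu : {measure set T -> \bar R}) : (nu setT < +oo)%E ->
    nu.-integrable D (EFin \o f).
  move=> nuoo; apply: measurable_bounded_integrable => //.
  by apply: le_lt_trans nuoo; apply: le_measure => //; rewrite inE.
have setToo (nu : probability T R) : (nu setT < +oo)%E.
  by rewrite probability_setT ltry.
have scale_setToo (c : {nonneg R}) (nu : probability T R) :
    (mscale c nu setT < +oo)%E.
  by rewrite /mscale [X in (_ * X)%E](probability_setT nu) mule1 ltry.
have Pint := fint _ (setToo P); have Qint := fint _ (setToo Q).
have scale_int (c : R) (c0 : 0 <= c) (nu : probability T R) :
    nu.-integrable D (EFin \o f) ->
    (\int[mscale (NngNum c0) nu]_(x in D) (f x)%:E)%E =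
    (c * \int[nu]_(x in D) f x)%:E.
  move=> nuint.
  have mfE := measurable_int _ nuint.
  (* Scaling of the measure is available for nonnegative integrands, so the integral is split into
     positive and negative parts, both finite. *)
  rewrite integralE !ge0_integral_mscale//.
  - rewrite [in RHS]/Rintegral [in RHS]integralE.
    rewrite -(fineK (integrable_pos_fin_num mD nuint)).
    rewrite -(fineK (integrable_neg_fin_num mD nuint)).
    by rewrite -!EFinM -!EFinB /= mulrBr.
  - exact: (measurable_funeneg mfE).
  - exact: (measurable_funepos mfE).
rewrite {1}/Rintegral (@eq_measure_integral _ _ _ _ mu) => [|A _ _]; last first.
  exact: (congr1 (@^~ A) SE).
rewrite /mu integral_measure_add//.
- by rewrite !scale_int.
- exact: (fint _ (scale_setToo _ _)).
- exact: (fint _ (scale_setToo _ _)).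
Qed.

(** The part of [D] outside [A] is negligible, lying in the complement of a set of probability 1. *)
Lemma Rintegral_full_measure (P : probability T R) (A D : set T) (f : T -> R) :
  measurable A -> measurable D -> A `<=` D -> P A = 1%E ->
  measurable_fun D f -> [bounded f x | x in D] ->
  \int[P]_(x in D) f x = \int[P]_(x in A) f x.
Proof.
move=> mA mD AD PA mf bf; congr fine.
rewrite (@negligible_integral _ _ _ _ D (D `\` A))//.
- by rewrite setDD (setIidr AD).
- exact: measurableD.
- apply: measurable_bounded_integrable => //.
  by apply: (le_lt_trans (probability_le1 P mD)); rewrite ltry.
- apply/eqP; rewrite eq_le measure_ge0 andbT.
  rewrite -[leRHS](_ : P (~` A) = 0%E); last by rewrite probability_setC// PA subee.
  by apply: le_measure => [||x []//]; rewrite inE; [exact: measurableD|exact: measurableC].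
Qed.

Lemma Rintegral_finite_partition (P : probability T R) (N : nat) (D : set T)
    (B : 'I_N -> set T) (f : T -> R) (F : 'I_N -> R) :
  (forall j, measurable (B j)) -> trivIset setT B -> D = \bigcup_j B j ->
  (forall j x, B j x -> f x = F j) ->
  \int[P]_(x in D) f x = \sum_(j < N) F j * fine (P (B j)).
Proof.
move=> mB tB DE fF.
have mDf : measurable_fun D f.
  by rewrite DE; exact: measurable_fun_finite_partition fF.
have DE' : D = \big[setU/set0]_(j <- index_enum 'I_N) B j.
  by rewrite DE -bigcup_seq; apply: eq_bigcupl; split=> // j _ /=;
    rewrite mem_index_enum.
rewrite DE' in mDf *.
rewrite /Rintegral integral_bigsetU_EFin//=.
- rewrite (eq_bigr (fun j => (F j * fine (P (B j)))%:E)) ?sumEFin// => j _.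
  rewrite (eq_integral (cst (F j)%:E)) => [|x /set_mem /fF ->//].
  by rewrite integral_cst// EFinM fineK//; exact: fin_num_measure.
- exact: index_enum_uniq.
- exact: sub_trivIset tB.
- exact/measurable_EFinP.
Qed.

End probability_tools.

Lemma bounded_le_cst (R : realType) (T : Type) (A : set T) (f : T -> R) (M : R) :
  (forall x, A x -> `|f x| <= M) -> [bounded f x | x in A].
Proof.
move=> fM; exists M; split; first exact: num_real.
by move=> M' /ltW MM' x /fM /le_trans; apply.
Qed.

(** * Borel sets of [R^d] *)

Section borel_sets.
Variables (R : realType) (d : nat).
Implicit Types A : set 'rV[R]_d.

Lemma open_borel A : open A -> measurable (A : set (borelRd R d)).
Proof. by move=> oA; exact: sub_sigma_algebra. Qed.

Lemma closed_borel A : closed A -> measurable (A : set (borelRd R d)).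
Proof.
move=> cA; rewrite -(setCK A); apply: measurableC; apply: open_borel.
exact: closed_openC.
Qed.

Lemma compact_borel A : compact A -> measurable (A : set (borelRd R d)).
Proof.
by move=> cA; apply: closed_borel; exact: compact_closed.
Qed.

Lemma set1_borel (x : 'rV[R]_d) : measurable ([set x] : set (borelRd R d)).
Proof. by apply: compact_borel; exact: compact_set1. Qed.

End borel_sets.

(** * Arbitrary norms on [R^d] and Lipschitz functions *)

Section norm_geometry.
Variables (R : realType) (d : nat) (nrm : 'rV[R]_d -> R).
Hypothesis nrm_norm : is_norm nrm.
Implicit Types (x y z : 'rV[R]_d) (X : set 'rV[R]_d).

Lemma normwN x : nrm (- x) = nrm x.
Proof. by rewrite -scaleN1r (norm_scale nrm_norm) normrN1 mul1r. Qed.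

Lemma normw0 : nrm 0 = 0.
Proof. by rewrite -(scale0r 0) (norm_scale nrm_norm) normr0 mul0r. Qed.

Lemma normw_distC x y : nrm (x - y) = nrm (y - x).
Proof. by rewrite -normwN opprB. Qed.

Lemma normw_ge0 x : 0 <= nrm x.
Proof.
have := norm_triangle nrm_norm x (- x); rewrite subrr normw0 normwN.
by rewrite -mulr2n pmulrn_lge0.
Qed.

Lemma normw_gt0 x : x != 0 -> 0 < nrm x.
Proof.
move=> x0; rewrite lt_neqAle normw_ge0 andbT eq_sym.
by apply: contra_neq x0; exact: (Defs.norm_eq0 nrm_norm).
Qed.

Lemma normw_dist_triangle x y z : nrm (x - z) <= nrm (x - y) + nrm (y - z).
Proof. by rewrite -[x - z](subrKA y) (norm_triangle nrm_norm). Qed.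

(** Half of the equivalence of norms: expand [x] in the standard basis and bound each coordinate by
    the sup norm. This is what makes [nrm]-balls open in the matrix topology. *)
Lemma normw_le_mx_norm : exists2 C, 0 < C & forall x, nrm x <= C * `|x|.
Proof.
have sum_ge0 : 0 <= \sum_(j < d) nrm (delta_mx 0 j).
  by apply: sumr_ge0 => j _; exact: normw_ge0.
(* The summand 1 keeps the constant positive even when [d = 0]. *)
exists (1 + \sum_(j < d) nrm (delta_mx 0 j)) => [|x]; first by lra.
have nrm_sum (r : seq 'I_d) (F : 'I_d -> 'rV[R]_d) :
    nrm (\sum_(j <- r) F j) <= \sum_(j <- r) nrm (F j).
  elim/big_rec2 : _ => [|j y1 y2 _ le12]; first by rewrite normw0.
  by apply: (le_trans (norm_triangle nrm_norm _ _)); rewrite lerD2l.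
rewrite {1}(row_sum_delta x); apply: (le_trans (nrm_sum _ _)).
rewrite mulrDl mul1r mulr_suml -[leLHS]add0r lerD//.
apply: ler_sum => j _; rewrite (norm_scale nrm_norm) mulrC.
apply: ler_wpM2l; first exact: normw_ge0.
by rewrite /Num.norm /= mx_normrE; exact: (le_bigmax _ _ (0, j)).
Qed.

Lemma open_normw_ball y (e : R) : open [set x | nrm (x - y) < e].
Proof.
rewrite openE => x /= xy; have [C C0 nrmC] := normw_le_mx_norm.
apply/nbhs_ballP; exists ((e - nrm (x - y)) / C) => /=.
  by rewrite divr_gt0// subr_gt0.
move=> z; rewrite -ball_normE /= ltr_pdivlMr// => xz.
apply: (le_lt_trans (normw_dist_triangle z x y)).
rewrite -ltrBrDr (le_lt_trans _ xz)// normw_distC mulrC; exact: nrmC.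
Qed.

Lemma closed_normw_ball y (e : R) : closed [set x | nrm (y - x) <= e].
Proof.
rewrite -openC openE => x /= /negP; rewrite -ltNge => exy.
have oU := @open_normw_ball x (nrm (y - x) - e).
have Ux : nrm (x - x) < nrm (y - x) - e by rewrite subrr normw0 subr_gt0.
apply: filterS (open_nbhs_nbhs (conj oU Ux)) => z /= zx.
apply/negP; rewrite -ltNge.
by have := normw_dist_triangle y z x; lra.
Qed.

(** Around a point [y] with [a < f y], the Lipschitz bound keeps [f] above [a] on the ball of radius
    [(f y - a) / L]; so the part of [X] where [f] exceeds [a] is the trace of an open set. *)
Lemma lipschitz_measurable X (L : R) (f : 'rV[R]_d -> R) :
  0 < L -> lipschitz_wrt nrm L X f ->
  measurable_fun (X : set (borelRd R d)) (f : borelRd R d -> R).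
Proof.
move=> L0 lipf mX; apply: (measurability _ (RGenOInfty.measurableE R)) => //.
move=> _ [_ [a ->] <-].
pose U := \bigcup_(y in [set y | X y /\ a < f y])
  [set x | nrm (x - y) < (f y - a) / L].
rewrite (_ : _ `&` _ = X `&` (U : set (borelRd R d))).
  apply: measurableI => //; apply: open_borel.
  by apply: bigcup_open => y _; exact: open_normw_ball.
apply/seteqP; split=> x [Xx]; rewrite /= ?in_itv /= ?andbT.
  by move=> afx; split=> //; exists x => //=; rewrite subrr normw0 divr_gt0// subr_gt0.
move=> [y [Xy afy] /=]; rewrite ltr_pdivlMr// mulrC => xy; split => //.
have := lipf _ _ Xx Xy; rewrite ler_norml => /andP[]; lra.
Qed.

Lemma lipschitz_bounded X (L : R) (f : 'rV[R]_d -> R) :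
  0 <= L -> compact X -> lipschitz_wrt nrm L X f -> [bounded f x | x in X].
Proof.
move=> L0 cX lipf; have [->|/set0P[y Xy]] := eqVneq X set0.
  by apply: (@bounded_le_cst _ _ _ _ 0).
have [C C0 nrmC] := normw_le_mx_norm.
have [M [_ XM]] := compact_bounded cX.
have {}XM x : X x -> `|x| <= M + 1 by apply: XM; rewrite ltrDl.
apply: (@bounded_le_cst _ _ _ _ (`|f y| + L * (C * (M + 1 + `|y|)))) => x Xx.
rewrite -[f x](subrK (f y)) addrC (le_trans (ler_normD _ _))// lerD2l.
apply: (le_trans (lipf _ _ Xx Xy)); apply: ler_wpM2l => //.
apply: (le_trans (nrmC _)); apply: ler_wpM2l; first exact: ltW.
by apply: (le_trans (ler_normB _ _)); rewrite lerD2r XM.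
Qed.

End norm_geometry.

(** * Finitely supported probabilities and bounds on integrals *)

Section finite_support.
Context dd (T : measurableType dd) (R : realType).

Lemma discrete_probability (N : nat) (w : 'I_N -> R) (z : 'I_N -> T) :
  (forall j, 0 <= w j) -> \sum_(j < N) w j = 1 ->
  exists P : probability T R,
    forall A, P A = (\sum_(j < N) w j * (z j \in A)%:R)%:E.
Proof.
move=> w0 w1.
(* [msum] is indexed by all naturals: weights are extended by 0, and below the points by [point],
   beyond [N]. *)
have w'0 (k : nat) : 0 <= oapp w 0 (insub k) by case: insub.
pose mu : {measure set T -> \bar R} :=
  msum (fun k => mscale (NngNum (w'0 k)) (dirac (oapp z point (insub k)))) N.
have muE A : mu A = (\sum_(j < N) w j * (z j \in A)%:R)%:E.
  rewrite -sumEFin; apply: eq_bigr => j _.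
  by rewrite /= /mscale /= valK /= diracE -EFinM.
have [|P PE] := @probability_of_measure _ _ _ mu.
  by rewrite muE -[in RHS]w1; congr EFin; apply: eq_bigr => j _; rewrite in_setT mulr1.
by exists P => A; rewrite PE; exact: muE.
Qed.

(** The integral reduces to the range of [z], which is partitioned into singletons; injectivity of
    [z] makes them disjoint. *)
Lemma Rintegral_finite_support (P : probability T R) (N : nat) (z : 'I_N -> T)
    (D : set T) (f : T -> R) :
  (forall x, measurable [set x : T]) -> injective z -> range z `<=` D ->
  measurable D -> P (range z) = 1%E -> measurable_fun D f ->
  [bounded f x | x in D] ->
  \int[P]_(x in D) f x = \sum_(j < N) f (z j) * fine (P [set z j]).
Proof.
move=> m1 zI zD mD Pz mf bf.
have rangeE : range z = \bigcup_j [set z j].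
  apply/seteqP; split=> [_ [j _ <-]|x [j _ ->]]; first by exists j.
  by exists j.
have mz : measurable (range z).
  by rewrite rangeE; exact: fin_bigcup_measurable.
rewrite (@Rintegral_full_measure _ _ _ _ (range z))//.
apply: Rintegral_finite_partition => // [|j x ->//].
by move=> i j _ _ [x [/= -> /zI]].
Qed.

Lemma Rintegral_01 (P : probability T R) (D : set T) (f : T -> R) :
  measurable D -> measurable_fun D f -> (forall x, D x -> 0 <= f x <= 1) ->
  0 <= \int[P]_(x in D) f x <= 1.
Proof.
move=> mD mf f01.
have PDoo : (P D < +oo)%E by apply: (le_lt_trans (probability_le1 P mD)); rewrite ltry.
have PD : fine (P D) <= 1.
  by rewrite -lee_fin fineK ?fin_num_measure//; exact: probability_le1.
apply/andP; split; first by apply: Rintegral_ge0 => x /f01 /andP[].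
apply: le_trans PD; rewrite -[leRHS]mul1r -(Rintegral_cst P mD).
apply: le_Rintegral => // [||x /f01 /andP[]//].
- apply: measurable_bounded_integrable => //.
  apply: (@bounded_le_cst _ _ _ _ 1) => x /f01 /andP[f0 f1].
  by rewrite ger0_norm.
- apply: measurable_bounded_integrable => //.
  by apply: (@bounded_le_cst _ _ _ _ 1) => x _; rewrite normr1.
Qed.

Lemma Rintegral_dist_le (P : probability T R) (D : set T) (f g : T -> R) (e : R) :
  measurable D -> P D = 1%E -> measurable_fun D f -> measurable_fun D g ->
  [bounded f x | x in D] -> [bounded g x | x in D] ->
  (forall x, D x -> `|f x - g x| <= e) ->
  `|\int[P]_(x in D) f x - \int[P]_(x in D) g x| <= e.
Proof.
move=> mD PD mf mg bf bg fge.
have PDoo : (P D < +oo)%E by rewrite PD ltry.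
have intf : P.-integrable D (EFin \o f) by exact: measurable_bounded_integrable.
have intg : P.-integrable D (EFin \o g) by exact: measurable_bounded_integrable.
have intfg : P.-integrable D (EFin \o (fun x => f x - g x)).
  apply: measurable_bounded_integrable => //; first exact: measurable_funB.
  exact: (bounded_le_cst fge).
rewrite -RintegralB// (le_trans (le_normr_Rintegral _ _))//.
have -> : e = \int[P]_(x in D) e by rewrite Rintegral_cst// [X in fine X]PD mulr1.
apply: le_Rintegral => //.
- apply: measurable_bounded_integrable => //.
    by apply: measurableT_comp => //; exact: measurable_funB.
  by apply: (@bounded_le_cst _ _ _ _ e) => x Dx; rewrite normr_id fge.
- apply: measurable_bounded_integrable => //.
  by apply: (@bounded_le_cst _ _ _ _ `|e|).
Qed.

End finite_support.

(** * Measurable projection onto a net *)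

Section net_projection.
Variables (R : realType) (d : nat) (nrm : 'rV[R]_d -> R).
Hypothesis nrm_norm : is_norm nrm.
Variables (X : set 'rV[R]_d) (eps : R) (N : nat) (z : 'I_N -> 'rV[R]_d).
Hypotheses (X_compact : compact X) (z_net : eps_net nrm X eps z).

(** A point goes to the first net point within [eps] of it. The cell of [z j] is thus a closed ball
    in [X] minus the earlier balls, which is Borel. *)
Lemma net_projection : exists (B : 'I_N -> set (borelRd R d))
    (proj : 'rV[R]_d -> 'rV[R]_d),
  [/\ forall j, measurable (B j), trivIset setT B, X = \bigcup_j B j,
      forall j x, B j x -> proj x = z j
    & forall x, X x -> X (proj x) /\ nrm (proj x - x) <= eps].
Proof.
have [_ zX near_z] := z_net.
pose A (j : 'I_N) : set (borelRd R d) := X `&` [set x | nrm (z j - x) <= eps].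
pose B (j : 'I_N) : set (borelRd R d) :=
  A j `\` \bigcup_(i in [set i : 'I_N | (i < j)%N]) A i.
have mA j : measurable (A j).
  apply: measurableI; first exact: compact_borel.
  by apply: closed_borel; exact: closed_normw_ball.
have Binj i j x : B i x -> B j x -> i = j.
  wlog ij : i j / (i <= j)%N.
    by move=> H Bi Bj; case/orP: (leq_total i j) => /H; [|symmetry]; auto.
  move=> [Aix _] [_ nAx]; apply/val_inj/eqP; rewrite eqn_leq ij leqNgt.
  by apply/negP => lt_ij; apply: nAx; exists i.
have XE : X = \bigcup_j B j.
  apply/seteqP; split=> [x Xx|x [j _ [[]]]//].
  have [j0 zj0] := near_z _ Xx.
  (* The least index of a net point within [eps] of [x] puts [x] outside all earlier balls. *)
  case: (@arg_minnP _ j0 (fun j => nrm (z j - x) <= eps) val zj0) => j zj jmin.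
  exists j => //; split=> // -[i /= ij [_ /jmin]].
  by rewrite leqNgt ij.
(* Outside [X] there is no cell and [proj] takes the default value 0. *)
pose proj x := xget 0 [set y | exists2 j, B j x & y = z j].
have projE j x : B j x -> proj x = z j.
  move=> Bjx; rewrite /proj; case: xgetP => [y _ [i Bix ->]|/(_ (z j))].
    by rewrite (Binj _ _ _ Bix Bjx).
  by case; exists j.
exists B, proj; split=> //.
- by move=> j; apply: measurableD => //; exact: fin_bigcup_measurable.
- by move=> i j _ _ [x [Bix Bjx]]; exact: Binj Bix Bjx.
- rewrite XE => x [j _ Bjx]; rewrite (projE _ _ Bjx) -XE; split=> //.
  by have [[_]] := Bjx.
Qed.

End net_projection.

(** * Dependence of the minmax value on the radius *)

Section minmax_inequalities.
Variables (R : realType) (d : nat) (nrm : 'rV[R]_d -> R).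
Variables (X : set 'rV[R]_d) (m K : nat).
Variables (psi : 'I_K -> 'rV[R]_d -> R) (xhat : 'I_m -> seq 'rV[R]_d).
Hypothesis nrm_norm : is_norm nrm.
Hypothesis X_compact : compact X.
Hypothesis m_gt0 : (0 < m)%N.
Hypothesis psi_lip : forall k, lipschitz_wrt nrm 1 X (psi k).
Hypothesis xhat_nonempty : forall i, (0 < size (xhat i))%N.
Hypothesis xhat_in : forall i x, x \in xhat i -> X x.

Local Notation prob := (probability (borelRd R d) R).
Let mX : measurable (X : set (borelRd R d)) := compact_borel X_compact.

Let psi_measurable k :
  measurable_fun (X : set (borelRd R d)) (psi k : borelRd R d -> R).
Proof. exact: (lipschitz_measurable nrm_norm ltr01 (psi_lip k)). Qed.

Let psi_bounded k : [bounded psi k x | x in X].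
Proof. exact: (lipschitz_bounded nrm_norm ler01 X_compact (psi_lip k)). Qed.

Lemma empirical_full (xs : seq 'rV[R]_d) (A : set (borelRd R d)) :
  (0 < size xs)%N -> (forall x, x \in xs -> A x) -> empirical xs A = 1%E.
Proof.
move=> xs0 xsA; rewrite /empirical /= /mscale /= /msum (eq_bigr (fun=> 1%:E)).
  rewrite sumEFin sumr_const card_ord -EFinM mulVf// pnatr_eq0.
  by rewrite -lt0n.
by move=> j _; rewrite [LHS]diracE mem_set//; apply: xsA; rewrite mem_nth.
Qed.

(** The empirical measure has zero moment deviation from itself. It shows that all ambiguity sets
    are nonempty and serves as the second component of the mixture below. *)
Lemma empirical_ambiguity i (r : R) : 0 <= r ->
  exists2 Q : prob, ambiguity X psi (xhat i) r Q &
    forall f, expect X Q f = expect X (empirical (xhat i)) f.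
Proof.
move=> r0; have [|Q QE] := @probability_of_measure _ _ _ (empirical (xhat i)).
  exact: empirical_full.
have QX f : expect X Q f = expect X (empirical (xhat i)) f.
  congr fine; apply: eq_measure_integral => A _ _.
  exact: (congr1 (@^~ A) QE).
exists Q => //; split=> [|k]; last by rewrite QX subrr normr0.
rewrite /prob_on /= QE; apply: empirical_full => // x; exact: xhat_in.
Qed.

Lemma ambiguity_shrink i (r s : R) (P : prob) : 0 < r <= s ->
  ambiguity X psi (xhat i) s P ->
  exists2 P' : prob, ambiguity X psi (xhat i) r P' &
    forall f, measurable_fun (X : set (borelRd R d)) (f : borelRd R d -> R) ->
      (forall x, X x -> 0 <= f x <= 1) ->
      expect X P' f <= expect X P f + (s - r) / s.
Proof.
move=> /andP[r0 rs] [PX Ppsi]; have s0 : 0 < s := lt_le_trans r0 rs.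
have [Q [QX _] Qemp] := empirical_ambiguity i (lexx 0).
(* The weight is chosen so that [(1 - t) * s = r]. *)
pose t := (s - r) / s.
have ts : t * s = s - r by rewrite /t divfK// gt_eqF.
have t01 : 0 <= t <= 1.
  by rewrite divr_ge0 ?subr_ge0 ?(ltW s0)//= ler_pdivrMr// mul1r lerBlDr lerDl ltW.
have /andP[t0 t1] := t01.
have [S [SE SintE]] := probability_mixture P Q t01.
exists S.
  split=> [|k]; first by rewrite /prob_on /= SE PX QX !mule1 -EFinD subrK.
  rewrite -[in X in _ - X]Qemp /expect SintE//.
  (* Mixing with [Q], whose moments are the empirical ones, multiplies the deviation of [P] by
     [1 - t]. *)
  rewrite (_ : _ - _ = (1 - t) * (expect X P (psi k) - expect X Q (psi k))).
    rewrite normrM ger0_norm ?subr_ge0// Qemp.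
    apply: (@le_trans _ _ ((1 - t) * s)); last by rewrite mulrBl ts; lra.
    by rewrite ler_wpM2l ?subr_ge0.
  by rewrite /expect; ring.
move=> f mf f01; have bf : [bounded f x | x in X].
  apply: (@bounded_le_cst _ _ _ _ 1) => x /f01 /andP[f0 f1].
  by rewrite ger0_norm.
have /andP[Pf0 Pf1] := Rintegral_01 P mX mf f01.
have /andP[Qf0 Qf1] := Rintegral_01 Q mX mf f01.
(* The change is [t] times a difference of two numbers in [[0, 1]], hence at most [t]. *)
rewrite /expect SintE// -/t; nra.
Qed.

(** [bayes_error] and [bayes_error_net] share this shape, so their bounds are proved once. *)
Lemma bayes_form_01 (e : 'I_m -> R) : (forall i, 0 <= e i <= 1) ->
  0 <= 1 - m%:R^-1 * \sum_(i < m) e i <= 1.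
Proof.
move=> e01; have e0 : 0 <= \sum_(i < m) e i.
  by apply: sumr_ge0 => i _; have /andP[] := e01 i.
have em : \sum_(i < m) e i <= m%:R.
  rewrite -[leRHS](_ : \sum_(i < m) 1 = _); last by rewrite sumr_const card_ord.
  by apply: ler_sum => i _; have /andP[] := e01 i.
have m0 : 0 < m%:R :> R by rewrite ltr0n.
by rewrite mulrC subr_ge0 ler_pdivrMr// mul1r em /= gerBl divr_ge0.
Qed.

(** The equal priors sum to 1, so a shift of [c] in each class costs [c] in total. *)
Lemma bayes_form_le (e e' : 'I_m -> R) (c : R) :
  (forall i, e' i <= e i + c) ->
  1 - m%:R^-1 * \sum_(i < m) e i <= 1 - m%:R^-1 * \sum_(i < m) e' i + c.
Proof.
move=> ee'; have m0 : 0 < m%:R :> R by rewrite ltr0n.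
have : \sum_(i < m) e' i <= \sum_(i < m) e i + c * m%:R.
  rewrite -[c * _](_ : \sum_(i < m) c = _) ?mulr_natr; last by rewrite sumr_const card_ord.
  by rewrite -big_split; apply: ler_sum.
rewrite -(ler_pM2l (_ : 0 < m%:R^-1)) ?invr_gt0// mulrDr (mulrC c) mulrA.
by rewrite mulVf ?gt_eqF// mul1r; lra.
Qed.

Lemma simplex_nonempty : @simplex R m !=set0.
Proof.
exists [tuple (i == Ordinal m_gt0)%:R | i < m]; split=> [i|].
  by rewrite tnth_mktuple; case: (_ == _); rewrite ?lexx ?ler01.
under eq_bigr do rewrite tnth_mktuple.
rewrite (bigD1 (Ordinal m_gt0))// big1 => [|i /negbTE ->//].
by rewrite eqxx; exact: addr0.
Qed.

Lemma decision_rule_nonempty : @decision_rule R d m X !=set0.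
Proof.
have [v sv] := simplex_nonempty; exists (fun=> v).
by split=> //; exact: measurable_cst.
Qed.

Lemma decision_rule_component (phi : 'rV[R]_d -> m.-tuple R) i :
  decision_rule X phi ->
  measurable_fun (X : set (borelRd R d))
    ((fun x => tnth (phi x) i) : borelRd R d -> R) /\
  forall x, X x -> 0 <= tnth (phi x) i <= 1.
Proof.
move=> [mphi phiS]; split=> [|x /phiS [] //].
exact: (measurableT_comp (@measurable_tnth _ _ _ i) mphi).
Qed.

Lemma bayes_error_01 (phi : 'rV[R]_d -> m.-tuple R) (P : 'I_m -> prob) :
  decision_rule X phi -> 0 <= bayes_error X phi P <= 1.
Proof.
move=> phiD; apply: bayes_form_01 => i.
have [mphi phi01] := decision_rule_component i phiD.
exact: Rintegral_01.
Qed.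

Lemma ambiguity_family_nonempty (r : R) : 0 <= r ->
  [set P : 'I_m -> prob | forall i, ambiguity X psi (xhat i) r (P i)] !=set0.
Proof.
move=> r0; have /choice[Q QE] : forall i, exists Q : prob,
    ambiguity X psi (xhat i) r Q.
  by move=> i; have [Q QA _] := empirical_ambiguity i r0; exists Q.
by exists Q.
Qed.

(** The rule is kept and each adversarial measure is replaced separately. Taking [P' = P] and
    [c = 0] gives monotonicity; taking the mixture gives the growth bound. *)
Lemma minmax_value_le_add (r s c : R) : 0 <= r -> 0 <= s ->
  (forall i (P : prob), ambiguity X psi (xhat i) s P ->
    exists2 P' : prob, ambiguity X psi (xhat i) r P' &
    forall f, measurable_fun (X : set (borelRd R d)) (f : borelRd R d -> R) ->
      (forall x, X x -> 0 <= f x <= 1) ->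
      expect X P' f <= expect X P f + c) ->
  minmax_value X psi xhat s <= minmax_value X psi xhat r + c.
Proof.
move=> r0 s0 shrink; apply: inf_sup_le.
- exact: decision_rule_nonempty.
- exact: ambiguity_family_nonempty.
- by move=> phi P phiD _; exact: bayes_error_01.
- by move=> phi P phiD _; exact: bayes_error_01.
move=> phi phiD; exists phi => // P PA.
have /choice[P' P'E] : forall i, exists P' : prob,
    ambiguity X psi (xhat i) r P' /\
    forall f, measurable_fun (X : set (borelRd R d)) (f : borelRd R d -> R) ->
      (forall x, X x -> 0 <= f x <= 1) ->
      expect X P' f <= expect X (P i) f + c.
  by move=> i; have [P' ? ?] := shrink i (P i) (PA i); exists P'.
exists P' => [i|]; first by have [] := P'E i.
apply: bayes_form_le => i; have [_] := P'E i; apply.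
  by have [] := decision_rule_component i phiD.
by have [] := decision_rule_component i phiD.
Qed.

Lemma minmax_value_mono (r s : R) : 0 <= r -> r <= s ->
  minmax_value X psi xhat r <= minmax_value X psi xhat s.
Proof.
move=> r0 rs; have s0 := le_trans r0 rs.
rewrite -[leRHS]addr0; apply: minmax_value_le_add => // i P [PX Ppsi].
exists P => [|f _ _]; last by rewrite addr0.
by split=> // k; exact: le_trans rs.
Qed.

Lemma minmax_value_growth (r s : R) : 0 < r -> r <= s ->
  minmax_value X psi xhat s <= minmax_value X psi xhat r + (s - r) / s.
Proof.
move=> r0 rs; have s0 := lt_le_trans r0 rs.
apply: minmax_value_le_add; [exact: ltW|exact: ltW|] => i P PA.
by apply: ambiguity_shrink => //; rewrite r0.
Qed.

(** * Comparison with the minmax problem on a net *)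

Section net.
Variables (eps : R) (N : nat) (z : 'I_N -> 'rV[R]_d).
Hypothesis z_net : eps_net nrm X eps z.

Let z_inj : injective z. Proof. by have [] := z_net. Qed.

Let z_in : range z `<=` X.
Proof. by move=> _ [j _ <-]; have [] := z_net. Qed.

(* [Defs.pmf] is qualified because the library has its own [pmf]. *)
Lemma net_transport : exists proj : 'rV[R]_d -> 'rV[R]_d,
  (forall phi : 'rV[R]_d -> m.-tuple R, decision_rule_net z phi ->
     decision_rule X (phi \o proj)) /\
  forall i (r : R) (P : prob), ambiguity X psi (xhat i) r P ->
    exists2 S : prob, ambiguity_net X psi (xhat i) z (r + eps) S &
      forall f, expect X P (f \o proj) = \sum_(j < N) f (z j) * Defs.pmf S (z j).
Proof.
have [B [proj [mB tB XE projE near_proj]]] :=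
  net_projection nrm_norm X_compact z_net.
have projX f j x : B j x -> (f \o proj : _ -> R) x = f (z j).
  by move=> /projE /= ->.
exists proj; split=> [phi phiD|i r P [PX Ppsi]].
  split=> [|x]; last first.
    by rewrite XE => -[j _ /projE /= ->]; exact: phiD.
  (* [phi \o proj] is constant on each Borel cell, whatever [phi] is between net points. *)
  rewrite [X in measurable_fun X](XE : X = _ :> set (borelRd R d)).
  apply: (@measurable_fun_finite_partition _ _ _ _ _ B _ (phi \o z)) => // j x.
  by move=> /projE /= ->.
have sumB : \sum_(j < N) fine (P (B j)) = 1.
  transitivity (expect X P (fun=> 1)).
    rewrite /expect (@Rintegral_finite_partition _ _ _ P N X B _ (fun=> 1))//.
    by under [RHS]eq_bigr do rewrite mul1r.
  by rewrite /expect Rintegral_cst// [X in fine X]PX mulr1.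
(* [S] is the image of [P] under [proj]: the weight of [z j] is the mass of its cell. *)
have [|S SE] := discrete_probability (z : 'I_N -> borelRd R d) _ sumB.
  by move=> j; exact: fine_ge0.
have S_range : S (range z) = 1%E.
  rewrite SE -[in RHS]sumB; congr EFin; apply: eq_bigr => j _.
  by rewrite mem_set ?mulr1//; exists j.
have SX : S X = 1%E.
  rewrite SE -[in RHS]sumB; congr EFin; apply: eq_bigr => j _.
  by rewrite mem_set ?mulr1//; apply: z_in; exists j.
have S_pmf j : Defs.pmf S (z j) = fine (P (B j)).
  rewrite /Defs.pmf SE /= (bigD1 j)//= mem_set// mulr1 big1 ?addr0// => l lj.
  by rewrite memNset ?mulr0// => /= /z_inj /eqP; rewrite (negbTE lj).
have PE f : expect X P (f \o proj) = \sum_(j < N) f (z j) * Defs.pmf S (z j).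
  under eq_bigr do rewrite S_pmf.
  by rewrite /expect (@Rintegral_finite_partition _ _ _ P N X B _ (f \o z))//;
    exact: projX.
exists S => //; split=> //; split=> [//|k].
have -> : expect X S (psi k) = expect X P (psi k \o proj).
  rewrite PE /expect (@Rintegral_finite_support _ _ _ S N z)//.
  exact: set1_borel.
(* Triangle inequality through the moment of [P]: one term is at most [r], the other at most [eps]
   because [proj] moves points by at most [eps]. *)
rewrite -[_ - _](subrKA (expect X P (psi k))) addrC.
apply: (le_trans (ler_normD _ _)); apply: lerD; first exact: Ppsi.
apply: Rintegral_dist_le => //.
- rewrite [X in measurable_fun X](XE : X = _ :> set (borelRd R d)).
  by apply: (@measurable_fun_finite_partition _ _ _ _ _ B _ (psi k \o z)) => //;
    exact: projX.
- have [M [_ psiM]] := psi_bounded k.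
  apply: (@bounded_le_cst _ _ _ _ (M + 1)) => x /near_proj[Xp _].
  by apply: psiM => //; rewrite ltrDl.
- move=> x Xx; have [Xp px] := near_proj _ Xx.
  by apply: (le_trans (psi_lip k Xp Xx)); rewrite mul1r.
Qed.

Lemma expect_net i (r : R) (P : prob) (f : 'rV[R]_d -> R) :
  ambiguity_net X psi (xhat i) z r P ->
  measurable_fun (X : set (borelRd R d)) (f : borelRd R d -> R) ->
  [bounded f x | x in X] ->
  expect X P f = \sum_(j < N) f (z j) * Defs.pmf P (z j).
Proof.
move=> [_ Pz] mf bf; rewrite /expect (@Rintegral_finite_support _ _ _ P N z)//.
exact: set1_borel.
Qed.

Lemma bayes_error_net_01 (r : R) (phi : 'rV[R]_d -> m.-tuple R)
    (P : 'I_m -> prob) :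
  decision_rule_net z phi ->
  (forall i, ambiguity_net X psi (xhat i) z r (P i)) ->
  0 <= bayes_error_net z phi P <= 1.
Proof.
move=> phiD PA; apply: bayes_form_01 => i.
have pmf0 j : 0 <= Defs.pmf (P i) (z j) by exact: fine_ge0.
(* The masses at the net points sum to 1, by integrating the constant 1. *)
have pmf1 : \sum_(j < N) 1 * Defs.pmf (P i) (z j) = 1.
  rewrite -(expect_net (f := fun=> 1) (PA i))//.
    have [[PX _] _] := PA i.
    by rewrite /expect Rintegral_cst// [X in fine X]PX mulr1.
  by apply: (@bounded_le_cst _ _ _ _ 1) => x _; rewrite normr1.
apply/andP; split; last rewrite -[leRHS]pmf1.
  by apply: sumr_ge0 => j _; rewrite mulr_ge0//; have [/(_ i)/andP[]] := phiD j.
apply: ler_sum => j _; rewrite ler_wpM2r//.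
by have [/(_ i)/andP[]] := phiD j.
Qed.

(** The training points may lie off the net, so the empirical measures are first projected, at the
    cost of [eps] in the radius. *)
Lemma ambiguity_net_family_nonempty (r : R) : 0 <= r ->
  [set P : 'I_m -> prob |
    forall i, ambiguity_net X psi (xhat i) z (r + eps) (P i)] !=set0.
Proof.
move=> r0; have [proj [_ transport]] := net_transport.
have /choice[Q QE] : forall i, exists Q : prob,
    ambiguity_net X psi (xhat i) z (r + eps) Q.
  move=> i; have [P PA _] := empirical_ambiguity i r0.
  by have [S SA _] := transport _ _ _ PA; exists S.
by exists Q.
Qed.

(** A rule on [X] restricts to the net, where the adversary has fewer measures. The form [r + eps]
    of the radius guarantees that there are some. *)
Lemma minmax_value_net_le (r : R) : 0 <= r ->
  minmax_value_net X psi xhat z (r + eps) <= minmax_value X psi xhat (r + eps).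
Proof.
move=> r0; rewrite -[leRHS]addr0; apply: inf_sup_le.
- exact: decision_rule_nonempty.
- exact: ambiguity_net_family_nonempty.
- by move=> phi P phiD PA; exact: bayes_error_net_01 PA.
- by move=> phi P phiD _; exact: bayes_error_01.
move=> phi phiD; exists phi => [j|P PA].
  by have [_] := phiD; apply; apply: z_in; exists j.
exists P => [i|]; first by have [] := PA i.
apply: bayes_form_le => i; rewrite addr0.
have [mphi phi01] := decision_rule_component i phiD.
rewrite (expect_net (PA i))//.
apply: (@bounded_le_cst _ _ _ _ 1) => x /phi01 /andP[p0 p1].
by rewrite ger0_norm.
Qed.

(** A net rule composed with [proj] performs against [P] exactly as the net rule does against the
    projected measure, so no error is added. *)
Lemma minmax_value_le_net (r : R) : 0 <= r ->
  minmax_value X psi xhat r <= minmax_value_net X psi xhat z (r + eps).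
Proof.
move=> r0; rewrite -[leRHS]addr0.
have [proj [proj_rule transport]] := net_transport.
apply: inf_sup_le.
- by have [v sv] := simplex_nonempty; exists (fun=> v).
- exact: ambiguity_family_nonempty.
- by move=> phi P phiD _; exact: bayes_error_01.
- by move=> phi P phiD PA; exact: bayes_error_net_01 PA.
move=> phi /[dup] phiD /proj_rule phiD'; exists (phi \o proj) => // P PA.
have /choice[S SE] : forall i, exists S : prob,
    ambiguity_net X psi (xhat i) z (r + eps) S /\
    forall f, expect X (P i) (f \o proj) = \sum_(j < N) f (z j) * Defs.pmf S (z j).
  by move=> i; have [S ? ?] := transport _ _ _ (PA i); exists S.
exists S => [i|]; first by have [] := SE i.
apply: bayes_form_le => i; rewrite addr0.
by have [_ /(_ (fun x => tnth (phi x) i)) <-] := SE i.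
Qed.

End net.
End minmax_inequalities.

(** * Existence and cardinality of nets *)

Section net_cardinality.
Variables (R : realType) (d : nat) (nrm : 'rV[R]_d -> R).
Hypothesis nrm_norm : is_norm nrm.
Variable X : set 'rV[R]_d.

(** A finite subcover of [X] by open [nrm]-balls centred in [X]; its centres form a finite set,
    enumerated without repetition. *)
Lemma exists_eps_net (eps : R) : compact X -> 0 < eps ->
  exists (N : nat) (z : 'I_N -> 'rV[R]_d), eps_net nrm X eps z.
Proof.
move=> cX eps0; move: (cX); rewrite compact_cover => coverX.
have [|x Xx|D DX XD] := coverX _ X (fun y => [set x | nrm (x - y) < eps]).
- by move=> y _; exact: open_normw_ball.
- by exists x => //=; rewrite subrr normw0.
exists (size (finmap.enum_fset D)), (fun j => nth 0 (finmap.enum_fset D) j); split.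
- move=> i j /eqP; rewrite nth_uniq ?finmap.fset_uniq// => /eqP ij.
  exact: val_inj.
- move=> j; have zD : nth 0 (finmap.enum_fset D) j \in finmap.enum_fset D.
    exact: mem_nth.
  exact: set_mem (DX _ zD).
- move=> x /XD[y /= yD xy].
  have yD' : (index y (finmap.enum_fset D) < size (finmap.enum_fset D))%N by rewrite index_mem.
  exists (Ordinal yD'); rewrite /= nth_index// normw_distC//; exact: ltW.
Qed.

(** Two points near the same net point are at distance at most [eps + eps], so choosing a nearby net
    point is injective on the [f i]. *)
Lemma eps_net_size (eps : R) (N M : nat) (z : 'I_N -> 'rV[R]_d)
    (f : 'I_M -> 'rV[R]_d) :
  eps_net nrm X eps z -> (forall i, X (f i)) ->
  (forall i j, i != j -> eps + eps < nrm (f i - f j)) -> (M <= N)%N.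
Proof.
move=> [_ _ z_near] fX f_far.
have /choice[h hE] : forall i, exists j, nrm (z j - f i) <= eps.
  by move=> i; exact: z_near.
rewrite -[M]card_ord -[N]card_ord; apply: (@leq_card _ _ h) => i j hij.
apply/eqP; apply: contraT => /f_far; rewrite ltNge.
rewrite (le_trans (normw_dist_triangle nrm_norm _ (z (h i)) _))//.
by apply: lerD; [rewrite normw_distC|rewrite hij].
Qed.

(** An infinite [X] contains [M] distinct points; once [eps k] is below half of all their mutual
    distances, the net needs at least [M] points. *)
Lemma net_size_cvgy (eps : nat -> R) (N : nat -> nat)
    (z : forall k, 'I_(N k) -> 'rV[R]_d) :
  infinite_set X -> (forall k, eps_net nrm X (eps k) (z k)) ->
  eps @ \oo --> 0 -> N @ \oo --> \oo.
Proof.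
move=> /infinite_set_fset X_inf z_net eps_to0; apply/cvgnyPge => M.
have [D DX MD] := X_inf M.
pose f (i : 'I_M) := nth 0 (finmap.enum_fset D) i.
have iD (i : 'I_M) : (i < size (finmap.enum_fset D))%N by exact: leq_trans MD.
have fX i : X (f i) by apply: DX; exact: mem_nth.
have f_inj i j : f i = f j -> i = j.
  by move=> /eqP; rewrite nth_uniq ?finmap.fset_uniq// => /eqP/val_inj.
(* There are finitely many pairs, so one threshold on [k] serves them all. *)
have near_far : \forall k \near \oo, forall ij : 'I_M * 'I_M,
    ij.1 != ij.2 -> eps k + eps k < nrm (f ij.1 - f ij.2).
  apply: filter_forall => -[i j] /=.
  have [->|ij] := eqVneq i j; first by apply: nearW.
  have fij : 0 < nrm (f i - f j).
    by apply: normw_gt0 => //; rewrite subr_eq0; apply: contra_neq ij; exact: f_inj.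
  have fij2 : 0 < nrm (f i - f j) / 2 by rewrite divr_gt0.
  move/cvgrPdist_lt : eps_to0 => /(_ _ fij2); apply: filterS => k.
  rewrite sub0r normrN => lt_eps _; have := ler_norm (eps k); lra.
apply: filterS near_far => k far_k.
by apply: (eps_net_size (z_net k) fX) => i j ij; exact: (far_k (i, j)).
Qed.

End net_cardinality.

(** * Lipschitz constants and the convergence theorem *)

Lemma lipschitz_of_le (R : realType) (A : set R) (k : R) (g : R -> R) :
  (forall r s, A r -> A s -> r <= s -> 0 <= g s - g r <= k * (s - r)) ->
  k.-lipschitz_A (g : R^o -> R^o).
Proof.
move=> gk [r s] /= [Ar As]; have [rs|/ltW sr] := leP r s.
  have /andP[g0 gle] := gk _ _ Ar As rs.
  by rewrite distrC ger0_norm// [X in _ <= _ * X]distrC ger0_norm ?subr_ge0.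
have /andP[g0 gle] := gk _ _ As Ar sr.
by rewrite ger0_norm// [X in _ <= _ * X]ger0_norm ?subr_ge0.
Qed.

(** Every admissible constant bounds the slope, hence so does their infimum, even when it is
    [+oo]. *)
Lemma lipschitz_constant_ge_slope (R : realType) (A : set R) (g : R -> R) (r s : R) :
  A r -> A s ->
  (`|g r - g s|%:E <= lipschitz_constant A g * `|r - s|%:E)%E.
Proof.
move=> Ar As; have [->|rs] := eqVneq r s; first by rewrite !subrr !normr0 mule0.
have rs0 : 0 < `|r - s| by rewrite normr_gt0 subr_eq0.
rewrite -lee_pdivrMr// -EFinM; apply: le_ereal_inf_tmp => _ [k [_ k_lip] <-].
rewrite lee_fin ler_pdivrMr//.
by have := k_lip (r, s) (conj Ar As).
Qed.

Theorem theorem4 (R : realType) (d : nat) (nrm : 'rV[R]_d -> R)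
    (X : set 'rV[R]_d) (m K : nat)
    (psi : 'I_K -> 'rV[R]_d -> R) (xhat : 'I_m -> seq 'rV[R]_d)
    (Delta eta0 eta : R)
    (nrm_norm : is_norm nrm)
    (X_compact : compact X)
    (X_infinite : infinite_set X)
    (m_ge2 : (2 <= m)%N)
    (psi_lip : forall k, lipschitz_wrt nrm 1 X (psi k))
    (xhat_nonempty : forall i, (0 < size (xhat i))%N)
    (xhat_in : forall i x, x \in xhat i -> X x)
    (Delta_gt0 : 0 < Delta)
    (Delta_lt_eta0 : Delta < eta0)
    (eta0_lt_max : (eta0%:E < eta_max X psi xhat)%E)
    (eta_bounds : Delta <= eta <= eta0) :
  let g := minmax_value X psi xhat in
  let gamma := g eta in
  let gamma_net (N : nat) (z : 'I_N -> 'rV[R]_d) (eps : R) :=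
    minmax_value_net X psi xhat z (eta + eps) in
  let L0 := lipschitz_constant `[Delta, eta0] g in
  [/\ (L0 < +oo)%E,
      forall (eps : R) (N : nat) (z : 'I_N -> 'rV[R]_d),
        0 < eps -> eta + eps <= eta0 -> eps_net nrm X eps z ->
        ((`|gamma_net N z eps - gamma|)%:E <= L0 * eps%:E)%E
    & forall (eps : nat -> R) (N : nat -> nat)
             (z : forall k, 'I_(N k) -> 'rV[R]_d),
        (forall k, [/\ 0 < eps k, eta + eps k <= eta0
                     & eps_net nrm X (eps k) (z k)]) ->
        [/\ eps @ \oo --> 0 -> gamma_net (N k) (z k) (eps k) @[k --> \oo] --> gamma,
            eps @ \oo --> 0 -> N @ \oo --> \oo
          & (forall k M (w : 'I_M -> 'rV[R]_d),
               eps_net nrm X (eps k) w -> (N k <= M)%N) ->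
            N @ \oo --> \oo -> eps @ \oo --> 0]].
Proof.
have [Delta_le_eta _] := andP eta_bounds.
have eta_gt0 : 0 < eta := lt_le_trans Delta_gt0 Delta_le_eta.
have m_gt0 : (0 < m)%N := ltnW m_ge2.
move=> g gamma gamma_net L0.
have g_mono r s : 0 <= r -> r <= s -> g r <= g s.
  exact: (minmax_value_mono psi X_compact m_gt0 xhat_nonempty xhat_in).
(* Since [Delta <= s], the increment [(s - r) / s] is at most [(s - r) / Delta]. *)
have g_growth r s : Delta <= r -> r <= s -> g s <= g r + Delta^-1 * (s - r).
  move=> Dr rs; have r0 := lt_le_trans Delta_gt0 Dr.
  apply: (le_trans (minmax_value_growth nrm_norm X_compact m_gt0 psi_lip
    xhat_nonempty xhat_in r0 rs)).
  rewrite lerD2l mulrC ler_wpM2r ?subr_ge0// lef_pV2 ?posrE//.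
    exact: le_trans rs.
  exact: lt_le_trans rs.
have net_ge N z eps : eps_net nrm X eps z -> gamma <= gamma_net N z eps.
  by move=> z_net; apply: (minmax_value_le_net nrm_norm X_compact) => //;
    exact: ltW.
have net_le N z eps : eps_net nrm X eps z ->
    gamma_net N z eps <= g (eta + eps).
  by move=> z_net; apply: (minmax_value_net_le nrm_norm X_compact) => //;
    exact: ltW.
split.
- apply: (@le_lt_trans _ _ (Delta^-1)%:E); last exact: ltry.
  apply: ereal_inf_lbound; exists Delta^-1 => //.
  split; first by rewrite invr_ge0 ltW.
  apply: lipschitz_of_le => r s; rewrite /= !in_itv /= => /andP[Dr _] _ rs.
  have r0 := lt_le_trans Delta_gt0 Dr.
  by rewrite subr_ge0 g_mono ?(ltW r0)//= lerBlDl g_growth.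
- move=> eps N z eps0 eps_le z_net.
  (* [gamma_net] lies between [g eta] and [g (eta + eps)], and both radii are in the interval where
     [L0] applies. *)
  apply: (@le_trans _ _ (`|g (eta + eps) - g eta|)%:E).
    have := net_ge _ _ _ z_net; have := net_le _ _ _ z_net.
    by rewrite lee_fin /gamma => le1 le2; rewrite !ger0_norm; lra.
  rewrite [X in (_ * X)%E](_ : _ = `|eta + eps - eta|%:E); last first.
    by rewrite addrAC subrr add0r gtr0_norm.
  apply: lipschitz_constant_ge_slope; rewrite /= in_itv /= ?Delta_le_eta; lra.
move=> eps N z epsz; split=> [eps_to0|eps_to0|N_min N_tooo].
- apply: (@squeeze_cvgr _ _ _ _ (cst gamma) (fun k => gamma + Delta^-1 * eps k)).
  + apply: nearW => k; have [eps0 _ z_net] := epsz k.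
    rewrite (net_ge _ _ _ z_net)/= (le_trans (net_le _ _ _ z_net))//.
    by have := @g_growth eta (eta + eps k) Delta_le_eta; rewrite addrAC subrr
      add0r lerDl => /(_ (ltW eps0)).
  + exact: cvg_cst.
  + rewrite -[X in _ --> X]addr0 -[X in _ + X](mulr0 Delta^-1).
    by apply: cvgD; [exact: cvg_cst|apply: cvgM => //; exact: cvg_cst].
- apply: (net_size_cvgy (z := z) nrm_norm X_infinite _ eps_to0) => k.
  by have [_ _] := epsz k.
- apply/cvgrPdist_lt => e e0.
  (* Compare with a fixed [e]-net of [M] points. If [e <= eps k], it is also an [eps k]-net, so
     minimality gives [N k <= M], which fails for large [k]. *)
  have [M [w w_net]] := exists_eps_net nrm_norm X_compact e0.
  move/cvgnyPgt : N_tooo => /(_ M); apply: filterS => k.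
  have [eps0 _ _] := epsz k.
  rewrite sub0r normrN gtr0_norm// ltnNge => /negP MN; rewrite ltNge.
  apply/negP => e_eps; apply: MN; apply: (N_min k M w).
  have [w_inj wX w_near] := w_net; split=> // x /w_near[j wj].
  by exists j; exact: le_trans e_eps.
Qed.
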